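(* Let $(X,d)$ be a compact metric space and $f:X\to X$ a continuous map. Let $\mathbf a=(a_n)_{n\ge 1}$ be a sequence in $\mathbb N$ that is uniformly behaved in $\mathbb N$. Suppose $f$ is minimal, uniquely ergodic, and $\mathbf a$-mean Lyapunov stable. Then for every continuous function $\phi:X\to\mathbb C$ and every $x\in X$, $$\lim_{N\to\infty}\frac1N\sum_{n=1}^{N}\phi(f^{a_n}x)=\int_X\phi\,d\nu,$$ where $\nu$ is the unique $f$-invariant Borel probability measure on $X$.
   Context: $\mathbb N$ is the set of natural numbers; $f^n$ is the $n$-fold composition of $f$, $f^0=\mathrm{Id}$. A sequence $\mathbf a=(a_n)_{n\ge1}$ in $\mathbb N$ is uniformly behaved in $\mathbb N$ if for every real $0<\theta<1$, $\lim_{N\to\infty}\frac1N\sum_{n=1}^N e^{2\pi i a_n\theta}=0$. $f$ is minimal if for every $x\in X$ the orbit $\{f^nx\}_{n\ge0}$ is dense in $X$. $f$ is uniquely ergodic if it has exactly one invariant Borel probability measure. For $E\subset\mathbb N$ the $\mathbf a$-upper density is $\overline D_{\mathbf a}(E)=\limsup_{N\to\infty}\frac1N\#\{1\le n\le N: a_n\in E\}$ (indices $n$ are counted, i.e. with multiplicity). $f$ is $\mathbf a$-mean Lyapunov stable if for every $\epsilon>0$ there are $\delta>0$ and a set $E=E_\epsilon\subset\mathbb N$ with $\overline D_{\mathbf a}(E)<\epsilon$ such that for all $x,y\in X$ with $d(x,y)<\delta$ one has $d(f^{a_n}x,f^{a_n}y)<\epsilon$ for all $n\ge1$ with $a_n\notin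 E$. *)

(* Defs.v *)
From HB Require Import structures.
From mathcomp Require Import all_boot all_order all_algebra complex.
From mathcomp Require Import all_classical all_reals all_analysis.

Set Implicit Arguments.
Unset Strict Implicit.
Unset Printing Implicit Defensive.

Import Order.TTheory GRing.Theory Num.Theory.
Import numFieldNormedType.Exports.

Local Open Scope classical_set_scope.
Local Open Scope ring_scope.
Local Open Scope complex_scope.

(* A metric space with a distinguished point: [measurableType] requires its
   carrier to be pointed.  No generality is lost, because a space that carries
   a probability measure is nonempty. *)
#[short(type="pmetricType")]
HB.structure Definition PointedMetric (R : numDomainType) :=
  {X of Pointed X & Metric R X}.

Definition borel (X : ptopologicalType) := g_sigma_algebraType (@open X).

(* R[i]^o is R[i] with the topology of its modulus; R[i] itself carries no
   topology in the library. *)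
Definition cesaro_mean (R : realType) (u : nat -> R[i]) (N : nat) : R[i]^o :=
  (N%:R^-1 * \sum_(1 <= n < N.+1) u n : R[i]).

(* e^{i t} *)
Definition expi (R : realType) (t : R) : R[i] := cos t +i* sin t.

(* Sequences (a_n)_{n >= 1} are functions nat -> nat whose value at 0 is never
   used. *)
Definition uniformly_behaved (R : realType) (a : nat -> nat) : Prop :=
  forall theta : R, 0 < theta < 1 ->
    cesaro_mean (fun n => expi (2 * pi * (a n)%:R * theta)) @ \oo --> (0 : R[i]^o).

Definition upper_density (R : realType) (a : nat -> nat) (E : set nat) : \bar R :=
  limn_esup (fun N =>
    ((count (fun n => a n \in E) (index_iota 1 N.+1))%:R / N%:R : R)%:E).

Definition mean_lyapunov_stable (R : realType) (X : metricType R)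
    (a : nat -> nat) (f : X -> X) : Prop :=
  forall eps : R, 0 < eps ->
    exists (delta : R) (E : set nat),
      [/\ 0 < delta,
          (upper_density R a E < eps%:E)%E &
          forall x y : X, mdist x y < delta ->
            forall n, (1 <= n)%N -> ~ E (a n) ->
              mdist (iter (a n) f x) (iter (a n) f y) < eps].

Definition minimal_map (X : topologicalType) (f : X -> X) : Prop :=
  forall x : X, dense (range (fun n => iter n f x)).

Definition invariant_measure (R : realType) (X : ptopologicalType) (f : X -> X)
    (mu : probability (borel X) R) : Prop :=
  forall A : set (borel X), measurable A -> mu (f @^-1` A) = mu A.

(* Measures are functions on all subsets, so uniqueness is agreement on the
   Borel sets. *)
Definition uniquely_ergodic (R : realType) (X : ptopologicalType) (f : X -> X) :
    Prop :=
  exists2 mu : probability (borel X) R, invariant_measure f mu &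
    forall mu' : probability (borel X) R, invariant_measure f mu' ->
      forall A : set (borel X), measurable A -> mu' A = mu A.

Definition cintegral (R : realType) (X : ptopologicalType)
    (mu : probability (borel X) R) (phi : X -> R[i]) : R[i] :=
  (\int[mu]_x complex.Re (phi x))%R +i*
  (\int[mu]_x complex.Im (phi x))%R.

(* Main.v *)
Require Import Defs.
From mathcomp Require Import all_boot all_order all_algebra complex.
From mathcomp Require Import all_classical all_reals all_analysis.
From mathcomp Require Import measurable_realfun ring lra zify.
Set Implicit Arguments.
Unset Strict Implicit.
Unset Printing Implicit Defensive.

Import numFieldNormedType.Exports.
Import Order.TTheory GRing.Theory Num.Theory.
Local Open Scope classical_set_scope.
Local Open Scope ring_scope.

(** Write A_N(x) for the mean of phi(f^(a_n) x) over 1 <= n <= N; real and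
    imaginary parts are treated apart, so phi is real. The proof shows that the
    functions A_N are asymptotically f-invariant in the L^2 sense, and that
    stability upgrades this to a pointwise statement which minimality then
    propagates along orbits.

    Asymptotic invariance (mean_square_increment_cvg0). The correlations
    c(k,l), the integrals of phi o f^k times phi o f^l, form a positive
    semidefinite kernel that depends on k - l only. By Herglotz's theorem
    (herglotz) they are the Fourier coefficients of a positive functional L on
    the continuous functions on [0,1], whence
      int (A_N o f - A_N)^2 dnu = L(|e(t) - 1|^2 |p_N(t)|^2),
    with e(t) = exp(2 i pi t) and p_N the mean of e(a_n t) over 1 <= n <= N.
    Uniform behaviour says that p_N tends to 0 on ]0,1[, and at the endpoints
    the factor e(t) - 1 vanishes; the trigonometric polynomials under L are
    bounded and tend to 0 everywhere on [0,1], so their images under L tend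
    to 0 by bounded convergence (positive_linear_bounded_cvg0).

    No measure representing L is constructed. L is a limit along an
    ultrafilter of discrete Fejer sums, and bounded convergence is proved for
    every positive functional on a compact space by Daniell's lattice argument,
    which reduces it to Dini's theorem.

    From the mean square to points. Stability makes the A_N equicontinuous for
    large N (time_mean_equicontinuous), because the indices n with a_n in the
    exceptional set contribute a small fraction of the mean. Nonempty open sets
    have positive measure (invariant_open_gt0), so a difference
    A_N(f x) - A_N(x) that stayed away from 0 would do so on a ball around x
    and bound the integral of the square from below: it tends to 0 for every x
    (time_mean_increment_cvg0). Then A_N(f^k x) - A_N(x) tends to 0; orbits
    being dense, equicontinuity and compactness give that A_N(x) - A_N(y)
    tends to 0 uniformly in y (time_mean_unif_cvg0). Integrating in y, where
    A_N has integral int phi dnu by invariance, proves the claim. *)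

(** * Bounded convergence for positive functionals *)

(** L is defined on all functions but constrained only on continuous ones, so
    that it can be a limit of finite sums without any domain type. Positivity
    on K says that L is carried by K. *)
Definition positive_linear (R : realType) (T : topologicalType) (K : set T)
    (L : (T -> R) -> R) :=
  [/\ forall g h : T -> R, continuous g -> continuous h ->
        L (fun x => g x + h x) = L g + L h,
      forall c (g : T -> R), continuous g -> L (fun x => c * g x) = c * L g &
      forall g : T -> R, continuous g -> (forall x, K x -> 0 <= g x) ->
        0 <= L g].

Section positive_linear_theory.
Variables (R : realType) (T : topologicalType) (K : set T).
Variable L : (T -> R) -> R.
Hypothesis posL : positive_linear K L.

Lemma positive_linear_sum (I : Type) (s : seq I) (c : I -> R)
    (g : I -> T -> R) :
  (forall i, continuous (g i)) ->
  L (fun x => \sum_(i <- s) c i * g i x) = \sum_(i <- s) c i * L (g i).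
Proof.
case: posL => LD LZ _ cg; elim: s => [|i s IH].
  under eq_fun do rewrite big_nil; rewrite big_nil.
  rewrite -[RHS](mul0r (L (fun=> 0))) -LZ; last by move=> x; exact: cvg_cst.
  by under [in RHS]eq_fun do rewrite mul0r.
under eq_fun do rewrite big_cons; rewrite big_cons -IH -LZ// -LD//.
  by move=> x; apply: cvgM; [exact: cvg_cst|exact: cg].
apply: (continuous_big add_continuous) => j _ x.
by apply: cvgM; [exact: cvg_cst|exact: cg].
Qed.

Lemma positive_linear_sum2 (I : Type) (s : seq I) (c : I -> I -> R)
    (g : I -> I -> T -> R) : (forall i j, continuous (g i j)) ->
  L (fun x => \sum_(i <- s) \sum_(j <- s) c i j * g i j x) =
  \sum_(i <- s) \sum_(j <- s) c i j * L (g i j).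
Proof.
move=> cg; have pairsE (F : I * I -> R) : \sum_(i <- s) \sum_(j <- s) F (i, j) =
    \sum_(p <- [seq (i, j) | i <- s, j <- s]) F p by rewrite big_allpairs.
rewrite (pairsE (fun p => c p.1 p.2 * L (g p.1 p.2))).
rewrite -(positive_linear_sum _ (fun p => c p.1 p.2)) => [|p]; last exact: cg.
congr L; apply/funext => x.
by rewrite (pairsE (fun p => c p.1 p.2 * g p.1 p.2 x)).
Qed.

Lemma le_positive_linear (g h : T -> R) : continuous g -> continuous h ->
  (forall x, K x -> g x <= h x) -> L g <= L h.
Proof.
case: posL => LD LZ L0 cg ch gh.
have cNg : continuous (fun x => -1 * g x).
  by move=> x; apply: cvgM; [exact: cvg_cst|exact: cg].
rewrite -subr_ge0 -mulN1r -LZ// -LD//; apply: L0 => [x|x Kx].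
  exact: cvgD (ch x) (cNg x).
by rewrite mulN1r subr_ge0 gh.
Qed.

Lemma positive_linear_cst c : L (fun=> c) = c * L (fun=> 1).
Proof.
case: posL => _ <- //; last by move=> x; exact: cvg_cst.
by under [in RHS]eq_fun do rewrite mulr1.
Qed.

End positive_linear_theory.

Section bounded_convergence.
Variables (R : realType) (T : topologicalType) (K : set T).

(** Dini's theorem: the inequality v n < e at a point of K spreads to a
    neighbourhood and, by monotonicity, to all later indices, so compactness of
    K makes it uniform. *)
Lemma nonincreasing_cvg0_uniform (v : nat -> T -> R) : compact K ->
  (forall n, continuous (v n)) ->
  (forall m n, (m <= n)%N -> forall x, v n x <= v m x) ->
  (forall x, K x -> (v n x) @[n --> \oo] --> 0) ->
  forall e, 0 < e -> \forall n \near \oo, forall x, K x -> v n x < e.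
Proof.
move=> /compact_near_coveringP cK cv dv v0 e e0.
apply: (cK nat \oo (fun n x => v n x < e)) => x Kx.
have [m vme] : exists m, v m x < e.
  have /cvgrPdist_lt/(_ e e0)[m _ /(_ m (leqnn m))] := v0 x Kx.
  by rewrite sub0r normrN => ?; exists m; apply: le_lt_trans (ler_norm _) _.
have xm : \forall x' \near x, v m x' < e by exact: (cv m x _ (lt_nbhsl vme)).
exists ([set x' | v m x' < e], [set n | (m <= n)%N]) => [/=|[x' n]/= [+ mn]].
  by split => //; exists m.
by apply: le_lt_trans; exact: dv.
Qed.

Variable L : (T -> R) -> R.
Hypothesis posL : positive_linear K L.
Variables (h : nat -> T -> R) (M : R).
Hypotheses (cK : compact K) (ch : forall n, continuous (h n)).
Hypothesis h0M : forall n x, K x -> 0 <= h n x <= M.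

(* At each point u is below some member of the tail (h k)_(k >= n). This stands
   for u <= sup_(k >= n) h k, a function that need not be continuous, and keeps
   that u n tends to 0 pointwise if each u n is below the n-th tail. *)
Let below_tail n (u : T -> R) := continuous u /\
  forall x, K x -> 0 <= u x /\ exists2 k, (n <= k)%N & u x <= h k x.

Let inner n : set R := [set L u | u in below_tail n].

Let below_tail_h n : below_tail n (h n).
Proof.
by split => // x Kx; split; [case/andP: (h0M n Kx)|exists n].
Qed.

Let inner_has_sup n : has_sup (inner n).
Proof.
split; first by exists (L (h n)); exists (h n).
exists (L (fun=> M)) => _ [u [cu un] <-].
apply: (le_positive_linear posL) => // [x|x Kx]; first exact: cvg_cst.
have [_ [k _]] := un x Kx; move/le_trans; apply.
by case/andP: (h0M k Kx).
Qed.

Let le_inner n u : below_tail n u -> L u <= sup (inner n).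
Proof. by move=> un; apply: sup_upper_bound => //; exists u. Qed.

(** Daniell's argument. The numbers I_n = sup (inner n) bound L (h n), and one
    shows that they tend to 0. If u_n nearly attains I_n then so does the
    minimum v_n of u_0, ..., u_n: indeed min + max = sum, and the maximum of
    v_n and u_(n+1) is again below the n-th tail. The v_n decrease to 0
    pointwise, hence uniformly by Dini, and L (v_n) tends to 0. *)
Lemma positive_linear_bounded_cvg0 :
  (forall x, K x -> (h n x) @[n --> \oo] --> 0) -> L (h n) @[n --> \oo] --> 0.
Proof.
move=> h_0; apply/cvgrPdist_le => e e0.
(* The errors e / 2^(n+2) allowed at step n add up to less than e / 2. *)
have d0 n : 0 < e / 2 * 2 ^- n.+1 by rewrite !mulr_gt0// invr_gt0 exprn_gt0.
have /choice[u uP] n : exists u, below_tail n u /\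
    sup (inner n) - e / 2 * 2 ^- n.+1 < L u.
  by have [_ [u un <-] uL] := sup_adherent (d0 n) (inner_has_sup n); exists u.
pose fix v n := if n is m.+1 then (fun x => Num.min (v m x) (u n x)) else u 0%N.
have cv n : continuous (v n).
  elim: n => [|n IH] x /=; first by case: (uP 0%N) => -[].
  by apply: continuous_min; [exact: IH|case: (uP n.+1) => -[+ _] _; exact].
have v_ge0 n x : K x -> 0 <= v n x.
  move=> Kx; elim: n => [|n IH] /=.
    by have [[_ /(_ x Kx)[]]] := uP 0%N.
  by rewrite le_min IH/=; have [[_ /(_ x Kx)[]]] := uP n.+1.
have vu n x : v n x <= u n x by case: n => //= n; rewrite ge_min lexx orbT.
have dv m n : (m <= n)%N -> forall x, v n x <= v m x.
  move=> + x; elim: n => [|n IH]; first by rewrite leqn0 => /eqP->.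
  rewrite leq_eqVlt => /predU1P[->//|]; rewrite ltnS => /IH.
  by apply: le_trans => /=; rewrite ge_min lexx.
have v0 x : K x -> (v n x) @[n --> \oo] --> 0.
  move=> Kx; apply/cvgrPdist_lt => r r0.
  have /cvgrPdist_lt/(_ r r0)[m _ hm] := h_0 x Kx.
  exists m => // n /= mn; rewrite sub0r normrN ger0_norm ?v_ge0//.
  have [[_ /(_ x Kx)[_ [k nk unk]]] _] := uP n.
  apply: le_lt_trans (vu n x) _; apply: le_lt_trans unk _.
  have := hm k (leq_trans mn nk); rewrite sub0r normrN.
  exact/le_lt_trans/ler_norm.
have Lv n : sup (inner n) - e / 2 * (1 - 2 ^- n.+1) <= L (v n).
  elim: n => [|n IH].
    have [_ /ltW] := uP 0%N; apply: le_trans; rewrite lerD2l lerN2.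
    by rewrite expr1 ler_pM2l ?divr_gt0//; lra.
  have [[cu un] /ltW uL] := uP n.+1.
  pose w x := Num.max (v n x) (u n.+1 x).
  have cw : continuous w.
    move=> x; apply: continuous_max; [exact: cv|exact: cu].
  have Lw : L w <= sup (inner n).
    apply: le_inner; split => // x Kx; split.
      by rewrite le_max v_ge0.
    rewrite /w; case: leP => _; last first.
      have [[_ /(_ x Kx)[_ [k nk unk]]] _] := uP n.
      by exists k => //; exact: le_trans (vu n x) unk.
    by have [_ [k nk unk]] := un x Kx; exists k => //; exact: ltnW.
  case: posL => LD _ _.
  have : L w + L (v n.+1) = L (v n) + L (u n.+1).
    rewrite -LD// -LD//; congr L; apply/funext => x /=.
    by rewrite addrC addr_min_max.
  have half : 2 ^- n.+1 = 2 * 2 ^- n.+2 :> R.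
    by rewrite [in RHS]exprS invfM mulrA divff ?mul1r.
  by move: IH uL; rewrite half; lra.
pose c := L (fun=> 1).
have c0 : 0 <= c.
  by case: posL => _ _; apply => // x; exact: cvg_cst.
have r0 : 0 < e / 2 / (c + 1) by rewrite !divr_gt0// ltr_wpDl.
apply: filterS (nonincreasing_cvg0_uniform cK cv dv v0 r0) => n vr.
have Lh0 : 0 <= L (h n).
  by case: posL => _ _; apply => // x Kx; case/andP: (h0M n Kx).
rewrite sub0r normrN ger0_norm//.
apply: le_trans (le_inner (below_tail_h n)) _.
have : L (v n) <= e / 2.
  apply: (@le_trans _ _ (L (fun=> e / 2 / (c + 1)))).
    apply: (le_positive_linear posL) => // [x|x Kx].
      exact: cvg_cst.
    exact/ltW/vr.
  rewrite (positive_linear_cst posL) -/c mulrAC ler_pdivrMr ?ltr_wpDl//.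
  by rewrite ler_pM2l ?divr_gt0// lerDl.
have : e / 2 * (1 - 2 ^- n.+1) <= e / 2.
  by rewrite ler_piMr ?divr_ge0 ?ltW// gerDl oppr_le0 invr_ge0 exprn_ge0.
by have := Lv n; lra.
Qed.

End bounded_convergence.

(** * Herglotz's theorem *)

Section trigonometric_sums.
Variable R : realType.

(** Orthogonality of the characters of Z/M: multiplied by 2 sin(a), where 2a is
    the angle step, the sum telescopes. *)
Lemma sum_cos_roots_of_unity (M p q : nat) : (p < q + M)%N -> (q < p + M)%N ->
  \sum_(j < M) cos (2 * pi * (p%:R - q%:R) * (j%:R / M%:R)) =
  (M * (p == q))%:R :> R.
Proof.
wlog lepq : p q / (q <= p)%N => [H pM qM|pM _].
  have [/H->//|/ltnW qp] := leqP q p.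
  rewrite eq_sym -H//; apply: eq_bigr => j _; rewrite -cosN.
  by congr cos; ring.
case: eqVneq => [->|neq].
  under eq_bigr do rewrite subrr mulr0 mul0r cos0.
  by rewrite sumr_const card_ord muln1.
have ltqp : (q < p)%N by rewrite ltn_neqAle eq_sym neq.
have M0 : (0 < M)%N by lia.
have M0R : M%:R != 0 :> R by rewrite pnatr_eq0; lia.
rewrite muln0 -natrB//; set m := (p - q)%N.
have mM : (0 < m < M)%N by rewrite /m; lia.
pose a : R := pi * (m%:R / M%:R).
have sa : sin a != 0.
  rewrite gt_eqF// sin_gt0_pi// /a mulr_gt0 ?pi_gt0 ?divr_gt0 ?ltr0n//=.
  + rewrite gtr_pMr ?pi_gt0// ltr_pdivrMr ?ltr0n// mul1r ltr_nat.
    by case/andP: mM.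
  by case/andP: mM.
apply: (mulfI (mulf_neq0 (_ : 2 != 0) sa)) => //; rewrite mulr0 mulr_sumr.
pose s j : R := sin (a * (2 * j%:R - 1)).
transitivity (\sum_(0 <= j < M) (s j.+1 - s j)).
  rewrite big_mkord; apply: eq_bigr => j _.
  have -> : 2 * pi * m%:R * (j%:R / M%:R) = a * 2 * j%:R by rewrite /a; ring.
  rewrite /s; have -> : a * (2 * (j.+1)%:R - 1) = a * 2 * j%:R + a.
    by rewrite -natr1; ring.
  have -> : a * (2 * j%:R - 1) = a * 2 * j%:R - a by ring.
  by rewrite sinD sinB; ring.
rewrite telescope_sumr// /s mulr0 sub0r mulrN1 sinN opprK.
have -> : a * (2 * M%:R - 1) = - a + (pi *+ 2) *+ m.
  by rewrite -mulrnA -[pi *+ _]mulr_natr natrM /a; field.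
by rewrite (periodicn (@sinD2pi R)) sinN addNr.
Qed.

End trigonometric_sums.

Lemma fmap_ultra (S T : Type) (f : S -> T) (F : set_system S) :
  UltraFilter F -> UltraFilter (f @ F).
Proof.
move=> UF; split; first exact: fmap_proper_filter.
move=> G GF FG; apply/seteqP; split => // A GA.
have [//|FnA] := in_ultra_setVsetC (f @^-1` A) UF.
have /FG GnA : (f @ F) (~` A) by [].
by have := filter_not_empty G; rewrite -(setICr A); case; exact: filterI.
Qed.

Section herglotz.
Variables (R : realType) (c : nat -> nat -> R).
Hypothesis c_sym : forall k l, c k l = c l k.
Hypothesis c_shift : forall d k l, c (k + d) (l + d) = c k l.
Hypothesis c_pos : forall n (w : nat -> R),
  0 <= \sum_(k < n) \sum_(l < n) w k * w l * c k l.

(* With 2(n+1) nodes, the frequencies k - l of the kernel (|k - l| <= n) and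
   those tested against it (at most n) add up to less than the number of
   nodes, so no aliasing occurs. *)
Let M n := (2 * n.+1)%N.
Let node n j : R := j%:R / (M n)%:R.

(* The Fejer means of the Fourier series of c, sampled at the nodes; they are
   nonnegative because cos(x - y) splits into two squares of the form tested
   in c_pos. *)
Let weight n j : R := ((M n)%:R * n.+1%:R)^-1 *
  \sum_(k < n.+1) \sum_(l < n.+1)
    cos (2 * pi * (k%:R - l%:R) * node n j) * c k l.

Let fejer n (h : R -> R) : R := \sum_(j < M n) weight n j * h (node n j).

Let weight_ge0 n j : 0 <= weight n j.
Proof.
apply: mulr_ge0; first by rewrite invr_ge0 mulr_ge0.
pose x (k : nat) := 2 * pi * k%:R * node n j.
have -> : \sum_(k < n.+1) \sum_(l < n.+1)
    cos (2 * pi * (k%:R - l%:R) * node n j) * c k l =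
    \sum_(k < n.+1) \sum_(l < n.+1) cos (x k) * cos (x l) * c k l +
    \sum_(k < n.+1) \sum_(l < n.+1) sin (x k) * sin (x l) * c k l.
  rewrite -big_split; apply: eq_bigr => k _.
  rewrite -big_split; apply: eq_bigr => l _ /=.
  by rewrite -mulrDl -cosB /x; congr (cos _ * _); ring.
apply: addr_ge0; first exact: (c_pos n.+1 (cos \o x)).
exact: (c_pos n.+1 (sin \o x)).
Qed.

Let node01 n (j : 'I_(M n)) : `[0, 1]%classic (node n j).
Proof.
rewrite /= in_itv/= divr_ge0//= ler_pdivrMr ?ltr0n// mul1r ler_nat.
exact: ltnW.
Qed.

Let count_shift N d : (d <= N)%N ->
  (\sum_(k < N) \sum_(l < N) (k == d + l :> nat) = N - d)%N.
Proof.
move=> dN; rewrite exchange_big/=.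
transitivity (\sum_(l < N) (d + l < N))%N.
  apply: eq_bigr => l _; case: ltnP => [dl|dl].
    rewrite (bigD1 (Ordinal dl))//= eqxx big1 ?addn0// => k.
    by rewrite -val_eqE/= => /negbTE->.
  rewrite big1// => k _; apply/eqP; rewrite eqb0 neq_ltn.
  by rewrite (leq_trans (ltn_ord k) dl).
rewrite -(big_mkord xpredT (fun l => nat_of_bool (d + l < N)%N)).
rewrite (@big_cat_nat _ _ _ (N - d)%N) ?leq_subr//=.
rewrite big_nat (eq_bigr (fun=> 1%N)) => [|l /andP[_ lN]]; last first.
  by rewrite (_ : (d + l < N)%N)//; lia.
rewrite -big_nat sum_nat_const_nat muln1 subn0 big_nat big1 ?addn0//.
by move=> l /andP[lN _]; rewrite (_ : (d + l < N)%N = false)//; lia.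
Qed.

(* Only the pairs with k - l = q - p or k - l = p - q survive orthogonality;
   there are n + 1 - |p - q| of each kind. *)
Let fejer_cos n p q : (p + q <= n)%N ->
  fejer n (fun t => cos (2 * pi * (p%:R - q%:R) * t)) =
  c p q * (1 - (`|p - q|%N)%:R / n.+1%:R).
Proof.
wlog lepq : p q / (p <= q)%N => [H pqn|pqn].
  have [/H->//|/ltnW qp] := leqP p q.
  rewrite c_sym distnC -H// 1?addnC//; congr fejer; apply/funext => t.
  by rewrite -cosN; congr cos; ring.
have N0 : n.+1%:R != 0 :> R by rewrite pnatr_eq0.
have M0 : (M n)%:R != 0 :> R by rewrite pnatr_eq0.
pose h (t : R) := cos (2 * pi * (p%:R - q%:R) * t).
transitivity (((M n)%:R * n.+1%:R)^-1 *
  \sum_(k < n.+1) \sum_(l < n.+1) \sum_(j < M n)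
    cos (2 * pi * (k%:R - l%:R) * node n j) * c k l * h (node n j)).
  rewrite /fejer /weight; under eq_bigr do rewrite -[_ * h _]mulrA.
  rewrite -mulr_sumr; congr (_ * _).
  under eq_bigr do rewrite mulr_suml.
  rewrite exchange_big/=; apply: eq_bigr => k _.
  under eq_bigr do rewrite mulr_suml.
  by rewrite exchange_big.
have -> : \sum_(k < n.+1) \sum_(l < n.+1) \sum_(j < M n)
    cos (2 * pi * (k%:R - l%:R) * node n j) * c k l * h (node n j) =
  \sum_(k < n.+1) \sum_(l < n.+1)
    (n.+1%:R * c p q * (p + k == q + l)%N%:R
     + n.+1%:R * c p q * (p + l == q + k)%N%:R).
  apply: eq_bigr => k _; apply: eq_bigr => l _.
  transitivity (c k l / 2 * (
      \sum_(j < M n) cos (2 * pi * ((p + k)%:R - (q + l)%:R) * node n j)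
    + \sum_(j < M n) cos (2 * pi * ((p + l)%:R - (q + k)%:R) * node n j))).
    rewrite -big_split mulr_sumr; apply: eq_bigr => j _.
    rewrite !natrD /h; set t := node n j.
    have -> : 2 * pi * (p%:R + k%:R - (q%:R + l%:R)) * t =
      2 * pi * (p%:R - q%:R) * t + 2 * pi * (k%:R - l%:R) * t by ring.
    have -> : 2 * pi * (p%:R + l%:R - (q%:R + k%:R)) * t =
      2 * pi * (p%:R - q%:R) * t - 2 * pi * (k%:R - l%:R) * t by ring.
    by rewrite cosB cosD /=; field.
  have := ltn_ord k; have := ltn_ord l; move=> ln kn.
  rewrite !sum_cos_roots_of_unity; try (rewrite /M; lia).
  rewrite mulrDr /M !natrM; congr (_ + _).
    case: eqP => [e|_]; last by rewrite !mulr0.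
    have -> : c k l = c p q.
      rewrite -(c_shift p) addnC e (c_sym p) -[RHS](c_shift l).
      by rewrite addnC (addnC p).
    by field.
  case: eqP => [e|_]; last by rewrite !mulr0.
  have -> : c k l = c p q.
    rewrite c_sym -(c_shift p) addnC e (c_sym p) -[RHS](c_shift k).
    by rewrite addnC (addnC p).
  by field.
under eq_bigr do rewrite big_split; rewrite big_split/=.
have count_pq : \sum_(k < n.+1) \sum_(l < n.+1)
    n.+1%:R * c p q * (p + k == q + l)%N%:R =
    n.+1%:R * c p q * (n.+1 - (q - p))%N%:R.
  rewrite -(@count_shift n.+1 (q - p)%N); last lia.
  rewrite natr_sum mulr_sumr; apply: eq_bigr => k _.
  rewrite natr_sum mulr_sumr; apply: eq_bigr => l _.
  by congr (_ * _%:R); congr nat_of_bool; lia.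
rewrite [X in _ + X]exchange_big/= count_pq distnEr// natrB; last lia.
by rewrite /M natrM; field.
Qed.

Let fejerZ n b h : fejer n (fun t => b * h t) = b * fejer n h.
Proof. by rewrite mulr_sumr; apply: eq_bigr => j _; rewrite mulrCA. Qed.

Let fejerD n g h : fejer n (fun t => g t + h t) = fejer n g + fejer n h.
Proof. by rewrite -big_split; apply: eq_bigr => j _; rewrite mulrDr. Qed.

Let fejer1 n : fejer n (fun=> 1) = c 0 0.
Proof.
rewrite -[RHS]mulr1 -[X in _ * X]subr0 -(mul0r n.+1%:R^-1) -(distnn 0).
rewrite -fejer_cos//; congr fejer; apply/funext => t.
by rewrite subrr mulr0 mul0r cos0.
Qed.

Let fejer_ge0 n (h : R -> R) :
  (forall t : R, `[0, 1]%classic t -> 0 <= h t) -> 0 <= fejer n h.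
Proof.
move=> h0; apply: sumr_ge0 => j _.
by apply: mulr_ge0; [exact: weight_ge0|exact/h0/node01].
Qed.

Let fejer_bounded (h : R -> R) :
  continuous h -> exists B : R, forall n, `|fejer n h| <= B.
Proof.
move=> ch; have /compact_bounded[B [_ hB]] :
    compact (h @` `[0, 1]%classic).
  apply: continuous_compact; last exact: segment_compact.
  exact: continuous_subspaceT.
exists ((B + 1) * c 0 0) => n; rewrite -(fejer1 n) -fejerZ.
have hB1 t : `[0, 1]%classic t -> - (B + 1) <= h t <= B + 1.
  have BB : B < B + 1 by rewrite ltrDl.
  by move=> t01; rewrite -ler_norml; apply: (hB _ BB); exists t.
rewrite ler_norml; apply/andP; split.
  rewrite -subr_ge0 opprK -fejerD; apply: fejer_ge0 => t /hB1/andP[]; lra.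
rewrite -subr_ge0 -mulN1r -[- 1 * _]fejerZ -fejerD.
by apply: fejer_ge0 => t /hB1/andP[]; lra.
Qed.

(** The Fejer sums are uniformly bounded on each continuous function, so they
    converge along any ultrafilter finer than the filter of eventual sets, and
    limits along a filter are linear and positive. On a cosine they converge in
    the ordinary sense, which identifies the limit. *)
Lemma herglotz : exists2 L : (R -> R) -> R,
    positive_linear (`[0, 1]%classic : set R) L &
  forall p q, L (fun t => cos (2 * pi * (p%:R - q%:R) * t)) = c p q.
Proof.
have [U [UU sU]] := ultraFilterLemma (@eventually_filter).
have cvgU (h : R -> R) : continuous h -> cvg (fejer n h @[n --> U]).
  move=> /fejer_bounded[B hB].
  have := @segment_compact R (- B) B; rewrite compact_ultra => cB.
  have [||l [_ Ul]] := cB ((fun n => fejer n h) @ U).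
  - exact: fmap_ultra.
  - apply: (@filterE _ U) => n; rewrite /= in_itv/=.
    by have := hB n; rewrite ler_norml.
  by apply/cvg_ex; exists l.
exists (fun h => lim (fejer n h @[n --> U])).
  split=> [g h cg ch|b g cg|g cg g0].
  - by under eq_fun do rewrite fejerD; apply: limD; exact: cvgU.
  - under eq_fun do rewrite fejerZ.
    by apply: cvg_lim => //; apply: cvgM; [exact: cvg_cst|exact: cvgU].
  - by apply: limr_ge; [exact: cvgU|apply: nearW => n; exact: fejer_ge0].
move=> p q; apply: cvg_lim => //; apply: cvg_trans (cvg_app _ sU) _.
have : c p q * (1 - (`|p - q|%N)%:R * n.+1%:R^-1) @[n --> \oo] --> c p q.
  rewrite -[X in _ --> X]mulr1 -[X in _ * X]subr0 -(mulr0 (`|p - q|%N)%:R).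
  apply: cvgM; first exact: cvg_cst.
  apply: cvgB; first exact: cvg_cst.
  by apply: cvgM; [exact: cvg_cst|exact: cvg_harmonic].
apply: cvg_trans; apply: near_eq_cvg; exists (p + q)%N => // n /= pqn.
by rewrite fejer_cos.
Qed.

End herglotz.

(** * Integrals of continuous functions *)

Definition space_mean (R : realType) (X : pmetricType R)
    (nu : probability (borel X) R) (h : X -> R) : R :=
  (\int[nu]_x h (x : borel X))%R.

Section integral_of_continuous.
Variables (R : realType) (X : pmetricType R).
Variable nu : probability (borel X) R.
Hypothesis cX : compact [set: X].

Lemma continuous_iter (f : X -> X) n : continuous f -> continuous (iter n f).
Proof.
move=> cf; elim: n => [x|n IH x]; first exact: cvg_id.
by apply: (@continuous_comp _ _ _ (iter n f) f); [exact: IH|exact: cf].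
Qed.

Lemma open_borel_measurable (U : set X) :
  open U -> measurable (U : set (borel X)).
Proof. exact: sub_sigma_algebra. Qed.

Lemma continuous_borel_measurable (h : X -> R) :
  continuous h -> measurable_fun [set: borel X] (h : borel X -> R).
Proof.
move=> /continuousP ch; apply: (measurability _ (RGenOpens.measurableE R)).
move=> _ [_ [a [b ->] <-]]; rewrite setTI.
by apply: open_borel_measurable; apply: ch; exact: interval_open.
Qed.

Lemma continuous_compact_bounded (h : X -> R) : continuous h ->
  exists B, forall x, `|h x| <= B.
Proof.
move=> ch; have /compact_bounded[B [_ hB]] : compact (h @` [set: X]).
  by apply: continuous_compact => //; exact: continuous_subspaceT.
have BB : B < B + 1 by rewrite ltrDl.
by exists (B + 1) => x; apply: (hB _ BB); exists x.
Qed.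

Lemma continuous_integrable (h : X -> R) : continuous h ->
  nu.-integrable [set: borel X] (EFin \o (h : borel X -> R)).
Proof.
move=> ch; apply: measurable_bounded_integrable => //.
- exact: le_lt_trans (probability_le1 nu measurableT) (ltry 1).
- exact: continuous_borel_measurable.
- have [B hB] := continuous_compact_bounded ch.
  exists B; split; first exact: num_real.
  by move=> y By x _; exact: le_trans (hB x) (ltW By).
Qed.

Lemma space_mean_positive_linear : positive_linear [set: X] (space_mean nu).
Proof.
split=> [g h cg ch|b g cg|g cg g0].
- by rewrite /space_mean RintegralD//; exact: continuous_integrable.
- by rewrite /space_mean RintegralZl//; exact: continuous_integrable.
- by apply: Rintegral_ge0 => x _; exact: g0.
Qed.

Lemma space_mean1 : space_mean nu (fun=> 1) = 1.
Proof.
rewrite /space_mean Rintegral_cst// mul1r.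
exact: (congr1 fine (probability_setT nu)).
Qed.

Lemma space_mean_invariant (f : X -> X) (h : X -> R) :
  continuous f -> continuous h ->
  invariant_measure f nu -> space_mean nu (h \o f) = space_mean nu h.
Proof.
move=> cf ch invf.
have mf : measurable_fun [set: borel X] (f : borel X -> borel X).
  apply: (@measurability _ _ (borel X) (borel X) _ _ (@open X)) => //.
  move=> _ [U oU <-].
  by rewrite setTI; apply: open_borel_measurable; move/continuousP : cf; exact.
rewrite /space_mean /Rintegral; congr fine; apply: esym.
rewrite (eq_measure_integral (pushforward nu (f : borel X -> borel X))).
  rewrite integral_pushforward//.
  - exact: (measurable_int nu (continuous_integrable ch)).
  - apply: (@continuous_integrable (h \o f)) => x.
    by apply: continuous_comp; [exact: cf|exact: ch].
by move=> A mA _; exact: (esym (invf A mA)).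
Qed.

Lemma space_mean_iter (f : X -> X) (h : X -> R) n :
  continuous f -> continuous h -> invariant_measure f nu ->
  space_mean nu (fun x => h (iter n f x)) = space_mean nu h.
Proof.
move=> cf ch invf; elim: n => // n <-.
rewrite -[RHS](space_mean_invariant cf _ invf).
  by congr space_mean; apply/funext => x; rewrite iterSr.
move=> x; apply: (@continuous_comp _ _ _ (iter n f)); last exact: ch.
exact: continuous_iter.
Qed.

(** Every orbit meets U, so the preimages of U under the iterates of f cover the
    space; they all have the measure of U, which cannot be 0. *)
Lemma invariant_open_gt0 (f : X -> X) (U : set X) :
  continuous f -> minimal_map f -> invariant_measure f nu ->
  open U -> U !=set0 -> (0 < nu (U : set (borel X)))%E.
Proof.
move=> cf minf invf oU U0; rewrite lt0e measure_ge0 andbT; apply/eqP => nuU.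
pose V n : set (borel X) := iter n f @^-1` U.
have oV n : open (V n : set X).
  by apply: open_comp => // x _; exact: continuous_iter.
have nuV n : nu.-negligible (V n).
  apply/negligibleP; first exact: open_borel_measurable.
  elim: n => [//|n IH].
  have -> : V n.+1 = f @^-1` V n.
    by apply/seteqP; split => x; rewrite /V /preimage /= -iterSr.
  exact: etrans (invf _ (open_borel_measurable (oV n))) IH.
have VT : \bigcup_n V n = [set: borel X].
  apply/seteqP; split => // x _.
  have [y [Uy [n _ xy]]] := minf x U U0 oU.
  by exists n => //; rewrite /V /preimage /= xy.
have := negligible_bigcup nuV; rewrite VT => /(negligibleP _ measurableT).
by move=> /(etrans (esym (probability_setT nu)))/eqP; rewrite onee_eq0.
Qed.

Lemma space_mean_ge_open (h : X -> R) (U : set X) (e : R) :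
  continuous h -> open U ->
  (forall x, 0 <= h x) -> (forall x, U x -> e <= h x) ->
  e * fine (nu (U : set (borel X))) <= space_mean nu h.
Proof.
move=> ch oU h0 hU; have mU := open_borel_measurable oU.
have ih := continuous_integrable ch.
have ihU : nu.-integrable (U : set (borel X)) (EFin \o (h : borel X -> R)).
  exact: integrableS ih.
apply: (@le_trans _ _ (\int[nu]_(x in (U : set (borel X))) h x)%R).
  rewrite -Rintegral_cst//; apply: le_Rintegral => //.
  apply: (integrableS measurableT mU) => //.
  apply: (@continuous_integrable (fun=> e)) => x; exact: cvg_cst.
apply: fine_le; [exact: integrable_fin_num|exact: integrable_fin_num|].
apply: ge0_subset_integral => //; first exact: (measurable_int nu ih).
by move=> x _; rewrite lee_fin.
Qed.

End integral_of_continuous.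

(** * Spectral estimate of the increments of the time means *)

Definition time_mean (R : realType) (u : nat -> R) (N : nat) : R :=
  N%:R^-1 * \sum_(1 <= n < N.+1) u n.

Lemma normr_time_mean_le (R : realType) (u : nat -> R) (B : R) (N : nat) :
  0 <= B -> (forall n, `|u n| <= B) -> `|time_mean u N| <= B.
Proof.
move=> B0 uB; rewrite /time_mean normrM ger0_norm ?invr_ge0//.
case: N => [|N]; first by rewrite invr0 mul0r.
rewrite mulrC ler_pdivrMr// (le_trans (ler_norm_sum _ _ _))//.
apply: (@le_trans _ _ (\sum_(1 <= n < N.+2) B)); first exact: ler_sum.
by rewrite sumr_const_nat subn1 mulr_natr.
Qed.

Lemma continuous_time_mean (R : realType) (T : topologicalType)
    (u : nat -> T -> R) (N : nat) : (forall n, continuous (u n)) ->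
  continuous (fun x => time_mean (u ^~ x) N).
Proof.
move=> cu x; apply: cvgM; first exact: cvg_cst.
by apply: (continuous_big add_continuous) => n _; exact: cu.
Qed.

Lemma continuous_cos_scale (R : realType) (k : R) :
  continuous (fun t : R => cos (k * t)).
Proof.
move=> t; apply: (@continuous_comp _ _ _ _ cos); last exact: continuous_cos.
by apply: cvgM; [exact: cvg_cst|exact: cvg_id].
Qed.

Lemma continuous_sin_scale (R : realType) (k : R) :
  continuous (fun t : R => sin (k * t)).
Proof.
move=> t; apply: (@continuous_comp _ _ _ _ sin); last exact: continuous_sin.
by apply: cvgM; [exact: cvg_cst|exact: cvg_id].
Qed.

Lemma continuous_sqr (R : realType) (T : topologicalType) (g : T -> R) :
  continuous g -> continuous (fun x => g x ^+ 2).
Proof. by move=> cg x; exact: (cvgM (cg x) (cg x)). Qed.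

Lemma sqr_sum (R : comPzRingType) (I : Type) (s : seq I) (u : I -> R) :
  (\sum_(i <- s) u i) ^+ 2 = \sum_(i <- s) \sum_(j <- s) u i * u j.
Proof.
by rewrite expr2 mulr_suml; apply: eq_bigr => i _; rewrite mulr_sumr.
Qed.

Section spectral_measure.
Variables (R : realType) (X : pmetricType R) (f : X -> X).
Variable nu : probability (borel X) R.
Hypotheses (cX : compact [set: X]) (cf : continuous f).
Hypothesis invf : invariant_measure f nu.
Variable phi : X -> R.
Hypothesis cphi : continuous phi.

Lemma continuous_orbit n : continuous (fun x => phi (iter n f x)).
Proof.
move=> x; apply: (@continuous_comp _ _ _ (iter n f) phi); last exact: cphi.
exact: continuous_iter.
Qed.

Let correlation k l :=
  space_mean nu (fun x => phi (iter k f x) * phi (iter l f x)).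

Let continuous_corr k l :
  continuous (fun x => phi (iter k f x) * phi (iter l f x)).
Proof. by move=> x; apply: cvgM; exact: continuous_orbit. Qed.

Let space_mean_sqr (I : Type) (s : seq I) (w : I -> R) (b : I -> nat) :
  space_mean nu (fun x => (\sum_(i <- s) w i * phi (iter (b i) f x)) ^+ 2) =
  \sum_(i <- s) \sum_(j <- s) w i * w j * correlation (b i) (b j).
Proof.
rewrite -(positive_linear_sum2 (space_mean_positive_linear nu cX)) => [|i j].
  congr space_mean; apply/funext => x; rewrite sqr_sum.
  by apply: eq_bigr => i _; apply: eq_bigr => j _; rewrite mulrACA.
exact: continuous_corr.
Qed.

(** The spectral isometry: replacing phi o f^b by the character of frequency b
    turns mean squares over the space into values of L. Arbitrary finite
    families of frequencies are allowed, as the values of a may repeat and come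
    in any order. *)
Lemma spectral_functional : exists2 L : (R -> R) -> R,
    positive_linear (`[0, 1]%classic : set R) L &
  forall (I : Type) (s : seq I) (w : I -> R) (b : I -> nat),
  L (fun t => (\sum_(i <- s) w i * cos (2 * pi * (b i)%:R * t)) ^+ 2 +
              (\sum_(i <- s) w i * sin (2 * pi * (b i)%:R * t)) ^+ 2) =
  space_mean nu (fun x => (\sum_(i <- s) w i * phi (iter (b i) f x)) ^+ 2).
Proof.
have [|d k l|n w|L posL Lcos] := @herglotz R correlation.
- by move=> k l; congr space_mean; apply/funext => x; rewrite mulrC.
- rewrite -[RHS](space_mean_iter cX d cf (@continuous_corr k l) invf).
  by congr space_mean; apply/funext => x; rewrite !iterD.
- rewrite -(space_mean_sqr (index_enum 'I_n) (fun i => w i) (fun i => i)).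
  case: (space_mean_positive_linear nu cX) => _ _; apply => [x|x _].
    apply: continuous_sqr; apply: (continuous_big add_continuous) => i _ y.
    by apply: cvgM; [exact: cvg_cst|exact: continuous_orbit].
  exact: sqr_ge0.
exists L => // I s w b.
rewrite space_mean_sqr.
under [RHS]eq_bigr do under eq_bigr do rewrite -Lcos.
rewrite -(positive_linear_sum2 posL) => [|i j]; last first.
  exact: continuous_cos_scale.
congr L; apply/funext => t; rewrite !sqr_sum -big_split.
apply: eq_bigr => i _ /=; rewrite -big_split; apply: eq_bigr => j _ /=.
by rewrite mulrBr mulrBl cosB; ring.
Qed.

Variable a : nat -> nat.
Hypothesis cos_sin_mean : forall t : R, 0 < t < 1 ->
  time_mean (fun n => cos (2 * pi * (a n)%:R * t)) @ \oo --> 0 /\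
  time_mean (fun n => sin (2 * pi * (a n)%:R * t)) @ \oo --> 0.

(** The increments have spectral density (2 - 2 cos(2 pi t)) (C^2 + S^2), where
    C and S are the means of the cosines and of the sines. The first factor
    vanishes at the endpoints of [0,1], which is where C^2 + S^2 does not tend
    to 0. *)
Lemma mean_square_increment_cvg0 :
  space_mean nu (fun x => (time_mean (fun n => phi (iter (a n) f (f x))) N -
                           time_mean (fun n => phi (iter (a n) f x)) N) ^+ 2)
    @[N --> \oo] --> 0.
Proof.
have [L posL LE] := spectral_functional.
(* A_N o f - A_N as a list of coefficients and frequencies. *)
pose s N := [seq (N%:R^-1 : R, (a n).+1) | n <- index_iota 1 N.+1] ++
            [seq (- N%:R^-1 : R, a n) | n <- index_iota 1 N.+1].
have sumE N (u : nat -> R) : \sum_(p <- s N) p.1 * u p.2 =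
    time_mean (fun n => u (a n).+1) N - time_mean (fun n => u (a n)) N.
  by rewrite big_cat !big_map/= -!mulr_sumr mulNr.
pose C N t : R := time_mean (fun n => cos (2 * pi * (a n)%:R * t)) N.
pose S N t : R := time_mean (fun n => sin (2 * pi * (a n)%:R * t)) N.
pose h N (t : R) : R :=
  (2 - 2 * cos (2 * pi * t)) * (C N t ^+ 2 + S N t ^+ 2).
have hE N : L (h N) = space_mean nu (fun x =>
    (time_mean (fun n => phi (iter (a n) f (f x))) N -
     time_mean (fun n => phi (iter (a n) f x)) N) ^+ 2).
  transitivity (L (fun t =>
      (\sum_(i <- s N) i.1 * cos (2 * pi * (i.2)%:R * t)) ^+ 2 +
      (\sum_(i <- s N) i.1 * sin (2 * pi * (i.2)%:R * t)) ^+ 2)).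
    congr L; apply/funext => t.
    rewrite (sumE N (fun b => cos (2 * pi * b%:R * t))).
    rewrite (sumE N (fun b => sin (2 * pi * b%:R * t))) -/(C N t) -/(S N t).
    have -> : time_mean (fun n => cos (2 * pi * (a n).+1%:R * t)) N =
        C N t * cos (2 * pi * t) - S N t * sin (2 * pi * t).
      rewrite /C /S /time_mean -!mulrA !mulr_suml -mulrBr -sumrB; congr (_ * _).
      apply: eq_bigr => n _; rewrite -cosD; congr cos.
      by rewrite -natr1; ring.
    have -> : time_mean (fun n => sin (2 * pi * (a n).+1%:R * t)) N =
        S N t * cos (2 * pi * t) + C N t * sin (2 * pi * t).
      rewrite /C /S /time_mean -!mulrA !mulr_suml -mulrDr -big_split.
      congr (_ * _); apply: eq_bigr => n _ /=; rewrite -sinD; congr sin.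
      by rewrite -natr1; ring.
    rewrite /h; have := cos2Dsin2 (2 * pi * t).
    move: (cos _) (sin _) (C _ _) (S _ _) => x y c d xy.
    transitivity ((c ^+ 2 + d ^+ 2) * (x ^+ 2 + y ^+ 2 + 1 - 2 * x)); last ring.
    by rewrite xy; ring.
  rewrite LE; congr space_mean; apply/funext => x.
  rewrite (sumE N (fun b => phi (iter b f x))).
  by under eq_fun do rewrite iterSr.
under eq_fun do rewrite -hE.
apply: (@positive_linear_bounded_cvg0 _ _ _ _ posL h 8).
- exact: segment_compact.
- move=> N t; apply: cvgM.
    apply: cvgB; first exact: cvg_cst.
    by apply: cvgM; [exact: cvg_cst|exact: continuous_cos_scale].
  have cC : continuous (C N).
    by apply: continuous_time_mean => n; exact: continuous_cos_scale.
  have cS : continuous (S N).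
    by apply: continuous_time_mean => n; exact: continuous_sin_scale.
  by apply: cvgD; apply: continuous_sqr; [exact: cC|exact: cS].
- move=> N t _; have sqr_le1 (u : nat -> R) : (forall n, `|u n| <= 1) ->
      0 <= time_mean u N ^+ 2 <= 1.
    move=> u1; rewrite sqr_ge0/= -real_normK ?num_real//.
    by rewrite expr_le1// normr_time_mean_le.
  have /andP[C0 C1] : 0 <= C N t ^+ 2 <= 1.
    by apply: sqr_le1 => n; rewrite ler_norml cos_geN1 cos_le1.
  have /andP[S0 S1] : 0 <= S N t ^+ 2 <= 1.
    by apply: sqr_le1 => n; rewrite ler_norml sin_geN1 sin_le1.
  have := cos_geN1 (2 * pi * t); have := cos_le1 (2 * pi * t); rewrite /h.
  by move: (cos _) => x x1 x0; apply/andP; split; nra.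
- move=> t; rewrite /= in_itv/= => /andP[t0 t1].
  have [t01|t01] := boolP (0 < t < 1).
    have [C0 S0] := cos_sin_mean t01.
    rewrite -[X in _ --> X](mulr0 (2 - 2 * cos (2 * pi * t))).
    apply: cvgM; first exact: cvg_cst.
    have sqr0 (u : nat -> R) : u @ \oo --> 0 -> u n ^+ 2 @[n --> \oo] --> 0.
      by move=> u0; rewrite -[X in _ --> X](mulr0 0); exact: (cvgM u0 u0).
    by rewrite -[X in _ --> X](addr0 0); apply: cvgD; exact: sqr0.
  have -> : (fun N => h N t) = (fun=> 0); last exact: cvg_cst.
  apply/funext => N; rewrite /h.
  have -> : cos (2 * pi * t) = 1; last by rewrite mulr1 subrr mul0r.
  move: t01; rewrite !lt_neqAle t0 t1 !andbT negb_and !negbK.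
  move=> /orP[/eqP<-|/eqP->].
    by rewrite mulr0 cos0.
  by rewrite mulr1 mulrC mulr_natr cos2pi.
Qed.

End spectral_measure.

(** * From stability to pointwise convergence *)

Lemma compact_uniform_continuity (R : realType) (X : pmetricType R)
    (h : X -> R) :
  compact [set: X] -> continuous h -> forall e, 0 < e ->
  exists2 d, 0 < d & forall x y, mdist x y < d -> `|h x - h y| < e.
Proof.
move=> /compact_near_coveringP cX ch e e0.
have : \forall d \near 0^'+, [set: X] `<=`
    [set x | forall y, mdist x y < d -> `|h x - h y| < e].
  apply: (cX R (0^'+) (fun d x => forall y, mdist x y < d -> `|h x - h y| < e)).
  move=> x _; have e20 : 0 < e / 2 by rewrite divr_gt0.
  have /cvgrPdist_lt/(_ _ e20) := ch x.
  move=> /nbhs_ballP[r r0]; rewrite ballEmdist => hr.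
  have r20 : 0 < r / 2 by rewrite divr_gt0.
  exists (ball x (r / 2), [set d | d < r / 2]).
    split => /=; first by apply: nbhsx_ballx.
    exact: nbhs_right_lt.
  move=> [x' d] /= []; rewrite ballEmdist /= => xx' dr y x'y.
  have hx' : `|h x - h x'| < e / 2.
    by apply: (hr x'); rewrite /= (lt_trans xx')// gtr_pMr// invf_lt1// ltr1n.
  have hy : `|h x - h y| < e / 2.
    apply: (hr y) => /=; apply: le_lt_trans (metric_triangle x x' y) _.
    by rewrite [ltRHS]splitr ltrD// (lt_trans x'y).
  have -> : h x' - h y = (h x - h y) - (h x - h x') by ring.
  by rewrite (le_lt_trans (ler_normB _ _))// [ltRHS]splitr ltrD.
move=> [d /= d0 hd]; exists (d / 2); first by rewrite divr_gt0.
move=> x y; apply: (hd (d / 2)) => //=; last by rewrite divr_gt0.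
by rewrite sub0r normrN gtr0_norm ?divr_gt0// gtr_pMr// invf_lt1// ltr1n.
Qed.

Lemma limn_esup_lt (R : realType) (u : nat -> \bar R) (l : \bar R) :
  (limn_esup u < l)%E -> \forall n \near \oo, (u n < l)%E.
Proof.
move=> /ereal_inf_lt[_ [V Voo <-] Vl]; apply: filterS Voo => n Vn.
by apply: le_lt_trans Vl; apply: ereal_sup_ubound; exists n.
Qed.

Section equicontinuous_time_means.
Variables (R : realType) (X : pmetricType R) (f : X -> X) (a : nat -> nat).
Variable nu : probability (borel X) R.
Hypotheses (cX : compact [set: X]) (cf : continuous f).
Variable phi : X -> R.
Hypothesis cphi : continuous phi.

Let A N x := time_mean (fun n => phi (iter (a n) f x)) N.

Let cA N : continuous (A N).
Proof. by apply: continuous_time_mean => n; exact: continuous_orbit. Qed.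

(** The indices outside the exceptional set contribute at most r by uniform
    continuity of phi. The others are at most a proportion r of all, and
    contribute at most 2 B each, B being a bound on phi. The number r is chosen
    with r + 2 B r < e. *)
Lemma time_mean_equicontinuous : mean_lyapunov_stable a f ->
  forall e, 0 < e -> exists2 d, 0 < d &
  \forall N \near \oo, forall x y, mdist x y < d -> `|A N x - A N y| < e.
Proof.
move=> mls e e0; have [B hB] := continuous_compact_bounded cX cphi.
have B0 : 0 <= B by apply: le_trans (hB point).
pose r := e / (2 * B + 2).
have r0 : 0 < r by rewrite divr_gt0//; lra.
have re : r + 2 * B * r < e.
  have -> : e = r * (2 * B + 2) by rewrite mulfVK// gt_eqF//; lra.
  by lra.
have [d1 d10 phid1] := compact_uniform_continuity cX cphi r0.
have m0 : 0 < Num.min d1 r by rewrite lt_min d10.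
have [d [E [d0 /limn_esup_lt dE stable]]] := mls _ m0.
exists d => //; near=> N => x y xyd.
have N0 : (0 < N)%N by near: N; exists 1%N.
apply: le_lt_trans re; rewrite /A /time_mean -mulrBr -sumrB.
rewrite normrM ger0_norm ?invr_ge0// mulrC ler_pdivrMr ?ltr0n//.
apply: le_trans (ler_norm_sum _ _ _) _.
apply: (@le_trans _ _
    (\sum_(1 <= n < N.+1) (r + 2 * B * (a n \in E)%:R))).
  rewrite [leLHS]big_nat_cond [leRHS]big_nat_cond.
  apply: ler_sum => n /andP[/andP[n1 _] _].
  case: (boolP (a n \in E)) => [_|anE].
    rewrite mulr1 (le_trans (ler_normB _ _))//.
    by have := hB (iter (a n) f x); have := hB (iter (a n) f y); lra.
  rewrite mulr0 addr0 ltW//; apply: phid1.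
  have := stable x y xyd n n1; rewrite notin_setE in anE => /(_ anE).
  by rewrite lt_min => /andP[].
rewrite big_split/= sumr_const_nat subn1/= -mulr_sumr.
rewrite -[r *+ _]mulr_natr [leRHS]mulrDl lerD2l.
rewrite -[leRHS]mulrA ler_wpM2l ?mulr_ge0//.
rewrite -natr_sum -big_mkcond/= sum1_count -ler_pdivrMr ?ltr0n//.
have : (((count (fun n => a n \in E) (index_iota 1 N.+1))%:R / N%:R : R)%:E
  < (Num.min d1 r)%:E)%E by near: N.
by rewrite lte_fin lt_min => /andP[_ /ltW].
Unshelve. all: by end_near. Qed.

Hypothesis invf : invariant_measure f nu.
Hypotheses (minf : minimal_map f) (mls : mean_lyapunov_stable a f).
Hypothesis cos_sin_mean : forall t : R, 0 < t < 1 ->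
  time_mean (fun n => cos (2 * pi * (a n)%:R * t)) @ \oo --> 0 /\
  time_mean (fun n => sin (2 * pi * (a n)%:R * t)) @ \oo --> 0.

(** If the increment at x is at least e, equicontinuity with e / 4 at both x and
    f x keeps it above e / 2 on a fixed neighbourhood U of x, so that the mean
    square is at least (e / 2)^2 nu(U), for the same U at all large N. *)
Lemma time_mean_increment_cvg0 x : A N (f x) - A N x @[N --> \oo] --> 0.
Proof.
apply/cvgrPdist_lt => e e0; have e40 : 0 < e / 4 by rewrite divr_gt0.
have [d d0 eqc] := time_mean_equicontinuous mls e40.
pose U := (ball x d `&` f @^-1` ball (f x) d)°.
have Ux : U x.
  by apply: filterI; [exact: nbhsx_ballx|apply: cf; exact: nbhsx_ballx].
have oU : open U by exact: open_interior.
have nuU : 0 < fine (nu (U : set (borel X))).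
  apply: fine_gt0.
  rewrite (invariant_open_gt0 cf minf invf oU)/=; last by exists x.
  have := probability_le1 nu (open_borel_measurable oU).
  by move=> /le_lt_trans; apply; exact: ltry.
pose r := (e / 2) ^+ 2 * fine (nu (U : set (borel X))).
have r0 : 0 < r by rewrite mulr_gt0// exprn_gt0// divr_gt0.
have /cvgrPdist_lt/(_ r r0) :=
  mean_square_increment_cvg0 cX cf invf cphi cos_sin_mean.
move: eqc; apply: filterS2 => N eqc; rewrite sub0r normrN => small.
rewrite sub0r normrN ltNge; apply/negP => big.
have : r <= space_mean nu (fun y => (A N (f y) - A N y) ^+ 2).
  apply: space_mean_ge_open => //.
  - apply: continuous_sqr => y; apply: cvgB; last exact: cA.
    by apply: (@continuous_comp _ _ _ f (A N)); [exact: cf|exact: cA].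
  - by move=> y; exact: sqr_ge0.
  - move=> y /interior_subset[]; rewrite /preimage /= !ballEmdist /= => xy fxfy.
    rewrite -[leRHS]real_normK ?num_real// lerXn2r ?nnegrE//.
      by rewrite divr_ge0// ltW.
    have := eqc _ _ xy; have := eqc _ _ fxfy.
    have triangle : A N (f x) - A N x = (A N (f x) - A N (f y)) +
      (A N (f y) - A N y) - (A N x - A N y) by ring.
    have := ler_normB (A N (f x) - A N (f y) + (A N (f y) - A N y))
      (A N x - A N y).
    have := ler_normD (A N (f x) - A N (f y)) (A N (f y) - A N y).
    by move: big; rewrite triangle; lra.
by move=> /(lt_le_trans (le_lt_trans (ler_norm _) small)); rewrite ltxx.
Qed.

Lemma time_mean_orbit_cvg0 k x :
  A N (iter k f x) - A N x @[N --> \oo] --> 0.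
Proof.
elim: k => [|k IH].
  rewrite (_ : (fun N => _) = fun=> 0); first exact: cvg_cst.
  by apply/funext => N; rewrite subrr.
rewrite -[X in _ --> X](addr0 0).
under eq_fun => N do rewrite -(subrKA (A N (iter k f x))) addrC.
by rewrite /=; apply: cvgD IH _; exact: time_mean_increment_cvg0.
Qed.

(** Near a given y the means are compared through an orbit point f^k x close to
    y; compactness removes the dependence of k on y. *)
Lemma time_mean_unif_cvg0 x (e : R) : 0 < e ->
  \forall N \near \oo, forall y, `|A N x - A N y| < e.
Proof.
move=> e0; have e30 : 0 < e / 3 by rewrite divr_gt0.
have [d d0 eqc] := time_mean_equicontinuous mls e30.
move/compact_near_coveringP : (cX) => cov.
suff : \forall N \near \oo, [set: X] `<=` [set y | `|A N x - A N y| < e].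
  by apply: filterS => N AN y; exact: AN.
apply: (cov nat \oo (fun N y => `|A N x - A N y| < e)) => y _.
have [] : (ball y d)° `&` range (fun n => iter n f x) !=set0.
  by apply: minf; [exists y; exact: nbhsx_ballx|exact: open_interior].
move=> z [/interior_subset + [k _ kz]]; rewrite -{z}kz ballEmdist /= => ykd.
have /cvgrPdist_lt/(_ _ e30) orb := time_mean_orbit_cvg0 k x.
exists (ball y d,
    [set N | (forall y z, mdist y z < d -> `|A N y - A N z| < e / 3) /\
    `|0 - (A N (iter k f x) - A N x)| < e / 3]).
  by split; [exact: nbhsx_ballx|exact: filterI].
move=> [y' N] /= []; rewrite ballEmdist /= => yy' [eqN orbN].
have := eqN _ _ yy'; have := eqN _ _ ykd.
move: orbN; rewrite sub0r normrN.
move: (A N (iter k f x)) (A N x) (A N y) (A N y') => p q r s.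
move=> pq rp rs.
have -> : q - s = - (p - q) - (r - p) + (r - s) by ring.
apply: le_lt_trans (ler_normD _ _) _.
apply: (@le_lt_trans _ _ (`|p - q| + `|r - p| + `|r - s|)).
  by rewrite lerD2r (le_trans (ler_normB _ _))// normrN.
by lra.
Qed.

Lemma time_mean_cvg x : A N x @[N --> \oo] --> space_mean nu phi.
Proof.
apply/cvgrPdist_le => e e0; near=> N.
have N0 : N%:R != 0 :> R.
  by rewrite pnatr_eq0 -lt0n; near: N; exists 1%N.
have posI := space_mean_positive_linear nu cX.
have ccst (c : R) : continuous ((fun=> c) : X -> R) by move=> y; exact: cvg_cst.
have -> : space_mean nu phi = space_mean nu (A N).
  transitivity (space_mean nu (fun y =>
      \sum_(n <- index_iota 1 N.+1) N%:R^-1 * phi (iter (a n) f y))).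
    rewrite (positive_linear_sum posI) => [|n]; last exact: continuous_orbit.
    under eq_bigr do rewrite (space_mean_iter cX _ cf cphi invf).
    rewrite sumr_const_nat subn1/= -[_ * _ *+ _]mulr_natr.
    by rewrite mulrAC mulVf ?mul1r.
  by congr space_mean; apply/funext => y; rewrite /A /time_mean mulr_sumr.
have meancst c : space_mean nu (fun=> c) = c.
  by rewrite (positive_linear_cst posI) space_mean1 mulr1.
have close y : A N x - e <= A N y <= A N x + e.
  rewrite -ler_distlC ltW//; move: y; near: N; exact: time_mean_unif_cvg0.
rewrite ler_distl -(meancst (A N x - e)) -(meancst (A N x + e)).
by apply/andP; split; apply: (le_positive_linear posI) => // y _;
  case/andP: (close y).
Unshelve. all: by end_near. Qed.

End equicontinuous_time_means.

(** * Complex observables *)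

Section complex_means.
Variable R : realType.
Local Open Scope complex_scope.

Let ReD (x y : R[i]) : complex.Re (x + y) = complex.Re x + complex.Re y.
Proof. by case: x; case: y. Qed.

Let ImD (x y : R[i]) : complex.Im (x + y) = complex.Im x + complex.Im y.
Proof. by case: x; case: y. Qed.

Lemma cesaro_meanE (u : nat -> R[i]) N : cesaro_mean u N =
  time_mean (fun n => complex.Re (u n)) N +i*
  time_mean (fun n => complex.Im (u n)) N.
Proof.
rewrite /cesaro_mean /time_mean.
have -> : (N%:R : R[i])^-1 = (N%:R^-1)%:C by rewrite fmorphV rmorph_nat.
have <- : complex.Re (\sum_(1 <= n < N.+1) u n) =
    \sum_(1 <= n < N.+1) complex.Re (u n) by exact: (big_morph _ ReD).
have <- : complex.Im (\sum_(1 <= n < N.+1) u n) =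
    \sum_(1 <= n < N.+1) complex.Im (u n) by exact: (big_morph _ ImD).
case: (\sum_(1 <= n < N.+1) u n) => x y /=.
by apply/eqP; rewrite eq_complex /= !mul0r subr0 addr0 !eqxx.
Qed.

Lemma cvg_complexP (T : Type) (F : set_system T) (FF : Filter F)
    (u v : T -> R) (b c : R) :
  ((fun t => (u t +i* v t : R[i]^o)) @ F --> (b +i* c : R[i]^o)) <->
  (u @ F --> b) /\ (v @ F --> c).
Proof.
split=> [uv|[ub vc]].
  have close e : 0 < e -> \forall t \near F,
      Num.sqrt ((b - u t) ^+ 2 + (c - v t) ^+ 2) < e.
    move=> e0; have eC : 0 < (e%:C : R[i]) by rewrite ltcR.
    move/cvgrPdist_lt : uv => /(_ _ eC); apply: filterS => t.
    by rewrite normc_def ltcR.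
  split; apply/cvgrPdist_lt => e /close; apply: filterS => t;
    apply: le_lt_trans; rewrite -sqrtr_sqr ler_wsqrtr//.
    by rewrite lerDl sqr_ge0.
  by rewrite lerDr sqr_ge0.
apply/cvgrPdist_lt => -[e f]; rewrite ltcE /= => /andP[/eqP -> e0].
have e20 : 0 < e / 2 by rewrite divr_gt0.
move/cvgrPdist_lt : ub => /(_ _ e20); move/cvgrPdist_lt : vc => /(_ _ e20).
apply: filterS2 => t vt ut; rewrite normc_def ltcR /=.
apply: (@le_lt_trans _ _ (`|b - u t| + `|c - v t|)); last first.
  by rewrite [ltRHS]splitr ltrD.
move: (b - u t) (c - v t) => p q.
rewrite -[leRHS]ger0_norm ?addr_ge0// -(sqrtr_sqr (`|p| + `|q|)) ler_wsqrtr//.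
rewrite sqrrD -(real_normK (num_real p)) -(real_normK (num_real q)).
by rewrite -addrA lerD2l lerDr mulrn_wge0// mulr_ge0.
Qed.

End complex_means.

Unset Implicit Arguments.

Theorem theorem5 (R : realType) (X : pmetricType R) (f : X -> X) (a : nat -> nat)
    (nu : probability (borel X) R) :
  compact [set: X] ->
  continuous f ->
  uniformly_behaved R a ->
  minimal_map f ->
  uniquely_ergodic R f ->
  mean_lyapunov_stable a f ->
  invariant_measure f nu ->
  forall phi : X -> R[i], continuous (phi : X -> R[i]^o) ->
  forall x : X,
    cesaro_mean (fun n => phi (iter (a n) f x)) @ \oo --> (cintegral nu phi : R[i]^o).
Proof.
move=> cX cf ua minf _ mls invf phi cphi x.
have cos_sin (t : R) : 0 < t < 1 ->
    time_mean (fun n => cos (2 * pi * (a n)%:R * t)) @ \oo --> 0 /\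
    time_mean (fun n => sin (2 * pi * (a n)%:R * t)) @ \oo --> 0.
  move=> t01; have ut := ua t t01; apply/cvg_complexP.
  move: ut; apply: cvg_trans.
  by apply: near_eq_cvg; apply: nearW => N; rewrite cesaro_meanE.
have ReImK (z : R[i]) : (complex.Re z +i* complex.Im z)%C = z by case: z.
have [cRe cIm] : continuous (fun y => complex.Re (phi y)) /\
    continuous (fun y => complex.Im (phi y)).
  suff cReIm y : (complex.Re (phi z) @[z --> y] --> complex.Re (phi y)) /\
      (complex.Im (phi z) @[z --> y] --> complex.Im (phi y)).
    by split=> y; have [] := cReIm y.
  apply/cvg_complexP; rewrite ReImK; apply: cvg_trans (cphi y).
  by apply: near_eq_cvg; apply: nearW => z; rewrite ReImK.
have ReIm_cvg := conj
  (time_mean_cvg cX cf cRe invf minf mls cos_sin x)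
  (time_mean_cvg cX cf cIm invf minf mls cos_sin x).
apply: cvg_trans (iffRL (cvg_complexP _ _ _ _ _) ReIm_cvg).
by apply: near_eq_cvg; apply: nearW => N; rewrite cesaro_meanE.
Qed.
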